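(* The map $D\mapsto K_D$ is an order embedding of the partially ordered set $(\overline{\mathbf D},\subseteq)$ into the partially ordered set $(\overline{\mathbf K},\subseteq)$ of all coherent SDSes; its image is exactly the set of all conjunctive coherent SDSes, and on this image its inverse is the map $K\mapsto D_K$. Moreover, if the closure operator $\mathrm{cl}$ is finitary, then $D\mapsto K_D$ is also an order embedding of $(\overline{\mathbf D},\subseteq)$ into the partially ordered set $(\overline{\mathbf K}_{\mathrm{fin}},\subseteq)$ of all finitely coherent SDSes; its image is exactly the set of all conjunctive finitely coherent SDSes, and on this image its inverse is $K\mapsto D_K$.
   Context: Let $\mathcal T$ be a non-empty set (of ''things''). Let $\mathrm{cl}:\mathcal P(\mathcal T)\to\mathcal P(\mathcal T)$ be a closure operator: $A\subseteq\mathrm{cl}(A)$, $A\subseteq B\Rightarrow\mathrm{cl}(A)\subseteq\mathrm{cl}(B)$, $\mathrm{cl}(\mathrm{cl}(A))=\mathrm{cl}(A)$ for all $A,B\subseteq\mathcal T$. It is called finitary if $\mathrm{cl}(A)=\bigcup\{\mathrm{cl}(F):F\subseteq A,\ F\text{ finite}\}$ for all $A\subseteq\mathcal T$ (the empty set counts as finite). Let $\mathcal T_-\subseteq\mathcal T$ be a set of forbidden things and put $\mathcal T_+:=\mathrm{cl}(\emptyset)$; standing assumption: $\mathcal T_+\cap\mathcal T_-=\emptyset$. A coherent SDT is a set $D\subseteq\mathcal T$ with $\mathrm{cl}(D)=D$ and $D\cap\mathcal T_-=\emptyset$; $\overline{\mathbf D}$ is the set of all coherent SDTs. For $\mathcal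 W\subseteq\mathcal P(\mathcal T)$, $\Sigma_{\mathcal W}$ is the set of selection maps $\sigma:\mathcal W\to\mathcal T$ with $\sigma(S)\in S$ for all $S\in\mathcal W$, and $\sigma(\mathcal W):=\{\sigma(S):S\in\mathcal W\}$. An SDS is any $K\subseteq\mathcal P(\mathcal T)$. It is coherent if (K1) $\emptyset\notin K$; (K2) if $S_1\in K$ and $S_1\subseteq S_2\subseteq\mathcal T$ then $S_2\in K$; (K3) if $S\in K$ then $S\setminus\mathcal T_-\in K$; (K4) $\{t\}\in K$ for every $t\in\mathcal T_+$; (K5) for every non-empty $\mathcal W\subseteq K$ and every family $(t_\sigma)_{\sigma\in\Sigma_{\mathcal W}}$ with $t_\sigma\in\mathrm{cl}(\sigma(\mathcal W))$, one has $\{t_\sigma:\sigma\in\Sigma_{\mathcal W}\}\in K$. It is finitely coherent if it satisfies K1–K4 and K5 restricted to non-empty finite $\mathcal W\subseteq K$. For $D\subseteq\mathcal T$ let $K_D:=\{S\subseteq\mathcal T:S\cap D\neq\emptyset\}$, and for an SDS $K$ let $D_K:=\{t\in\mathcal T:\{t\}\in K\}$. An SDS $K$ is conjunctive if for every $S\in K$ there is $t\in S$ with $\{t\}\in K$. An order embedding is a map $f$ with $x\le y\iff f(x)\le f(y)$. *)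

(* Defs.v *)
From mathcomp Require Import all_boot all_order.
From mathcomp Require Import mathcomp_extra boolp classical_sets functions cardinality.

Set Implicit Arguments.
Unset Strict Implicit.
Unset Printing Implicit Defensive.

Local Open Scope classical_set_scope.

(* SDT: set of desirable things; SDS: set of desirable sets of things.  [Tm] is
   the set of forbidden things; the set of things that are always desirable
   is [cl set0]. *)
Section Desirability.
Variable T : Type.
Implicit Types (cl : set T -> set T) (Tm D S : set T) (K W : set (set T)).

Definition closure_operator cl : Prop :=
  [/\ forall A, A `<=` cl A,
      forall A B, A `<=` B -> cl A `<=` cl B
    & forall A, cl (cl A) = cl A].

Definition finitary cl : Prop :=
  forall A, cl A = \bigcup_(F in [set F | F `<=` A /\ finite_set F]) cl F.

Definition coherent_SDT cl Tm : set (set T) :=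
  [set D | cl D = D /\ D `&` Tm = set0].

(* The selection maps are genuine functions on the type of elements of [W],
   not restrictions of maps on [set T]: families indexed by [selection W] thus
   have exactly one member per selection map. *)
Definition selection W : set (W -> T) :=
  [set sigma | forall S : W, set_val S (sigma S)].
Arguments selection : clear implicits.

Definition K5_for cl K W : Prop :=
  forall t : selection W -> T,
    (forall sigma : selection W, cl (range (set_val sigma)) (t sigma)) ->
    K (range t).

Definition K1_to_K4 cl Tm K : Prop :=
  [/\ ~ K set0,
      forall S1 S2, K S1 -> S1 `<=` S2 -> K S2,
      forall S, K S -> K (S `\` Tm)
    & forall t, cl set0 t -> K [set t]].

Definition coherent_SDS cl Tm : set (set (set T)) :=
  [set K | K1_to_K4 cl Tm K /\
           forall W, W !=set0 -> W `<=` K -> K5_for cl K W].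

Definition finitely_coherent_SDS cl Tm : set (set (set T)) :=
  [set K | K1_to_K4 cl Tm K /\
           forall W, W !=set0 -> finite_set W -> W `<=` K -> K5_for cl K W].

Definition SDS_of D : set (set T) := [set S | S `&` D !=set0].

Definition SDT_of K : set T := [set t | K [set t]].

Definition conjunctive : set (set (set T)) :=
  [set K | forall S, K S -> exists2 t, S t & K [set t]].

End Desirability.

(* On [set T] the library's order [<=%O] is inclusion (lemma [subsetEset]). *)
Definition order_embedding d d' (X : porderType d) (Y : porderType d')
    (A : set X) (B : set Y) (f : X -> Y) : Prop :=
  set_fun A B f /\ {in A &, {mono f : x y / (x <= y)%O}}.

Definition inverse_between (X Y : Type) (A : set X) (B : set Y)
    (f : X -> Y) (g : Y -> X) : Prop :=
  [/\ set_fun B A g, {in A, cancel f g} & {in B, cancel g f}].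

(* Main.v *)
(* [SDT_of] recovers [D] from [SDS_of D]. [SDS_of D] is coherent because some
   selection map picks an element of [D] in every set of [W], so that its
   [t sigma] lies in [cl D = D]. Conversely, K5 applied to a family of
   singletons, which has a single selection map, shows that [SDT_of K] is
   closed; when only finite families are allowed, finitarity of [cl] reduces
   closedness to finite subsets. *)
Require Import Defs.
From mathcomp Require Import all_boot all_order.
From mathcomp Require Import mathcomp_extra boolp classical_sets functions cardinality.

Local Open Scope classical_set_scope.

Lemma SDS_ofK (T : Type) : cancel (@SDS_of T) (@SDT_of T).
Proof.
move=> D; apply/seteqP; split => t; first by move=> [s [/= ->]].
by move=> Dt; exists t.
Qed.

(** Upward closure gives the inclusion from left to right, conjunctivity the converse. *)
Lemma SDT_ofK (T : Type) (K : set (set T)) :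
  (forall S1 S2, K S1 -> S1 `<=` S2 -> K S2) -> conjunctive K ->
  SDS_of (SDT_of K) = K.
Proof.
move=> Kup Kconj; apply/seteqP; split => S.
  by move=> [t [St Kt]]; apply: Kup Kt _ => _ ->.
by move=> /Kconj [t St Kt]; exists t.
Qed.

Lemma SDS_of_conjunctive (T : Type) (D : set T) : conjunctive (SDS_of D).
Proof. by move=> S [t [St Dt]]; exists t => //; exists t. Qed.

Lemma SDS_of_mono (T : Type) (D E : set T) :
  (SDS_of D <= SDS_of E)%O = (D <= E)%O.
Proof.
apply/idP/idP; rewrite !subsetEset => sub; last first.
  by move=> S [t [St /sub Et]]; exists t.
move=> t Dt.
(* Singletons suffice as tests: [[set t]] meets [E] only if [t] lies in [E]. *)
by have [|_ [/= -> //]] := sub [set t]; exists t.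
Qed.

Lemma SDS_of_K1_to_K4 (T : Type) (cl : set T -> set T) (Tm D : set T) :
  closure_operator cl -> coherent_SDT cl Tm D -> K1_to_K4 cl Tm (SDS_of D).
Proof.
move=> [_ clS _] [clD DTm]; split => [[t []//]|S1 S2 [t [S1t Dt]] sub|S|t t0].
- by exists t; split; first exact: sub.
- move=> [t [St Dt]]; exists t; split=> //; split=> // Tmt.
  by have : (D `&` Tm) t by []; rewrite DTm.
- by exists t; split=> //; rewrite -clD; apply: clS t0.
Qed.

Lemma SDS_of_K5 (T : Type) (cl : set T -> set T) (D : set T) W :
  closure_operator cl -> cl D = D -> W `<=` SDS_of D ->
  K5_for cl (SDS_of D) W.
Proof.
move=> [_ clS _] clD WD t clt.
have /choice [f fP] (S : W) : exists x, set_val S x /\ D x.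
  by have [x [? ?]] := WD _ (set_valP S); exists x.
have sel_f : f \in selection (W:=W) by rewrite inE => S; have [] := fP S.
pose sigma : selection (W:=W) := SigSub sel_f.
exists (t sigma); split; first by exists sigma.
rewrite -clD; apply: clS (clt sigma) => _ [S _ <-].
by have [] := fP S.
Qed.

(** K5 is applied to the constant family with value [t]: every selection on the singletons of [F]
    has all of [F] in its range, so [t] is always an admissible choice. *)
Lemma SDT_of_closure (T : Type) (cl : set T -> set T) (K : set (set T)) F :
  closure_operator cl -> K5_for cl K (set1 @` F) -> cl F `<=` SDT_of K.
Proof.
move=> [_ clS _] K5 t Ft.
have /choice [f fP] (S : set1 @` F) : exists x, set_val S x.
  by have [x _ xS] := set_valP S; exists x; rewrite -[set_val S]xS.
have sel_f : f \in selection (W:=set1 @` F) by rewrite inE.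
pose sigma0 : selection (W:=set1 @` F) := SigSub sel_f.
(* The constant family has range [[set t]], and not the empty set, because the selection [sigma0]
   exists. *)
have -> : SDT_of K t = K (range (fun _ : selection (W:=set1 @` F) => t)).
  congr K; apply/seteqP; split => [_ ->|_ [_ _ <-//]].
  by exists sigma0.
apply: K5 => sigma; apply: clS Ft => x Fx.
have xF : [set x] \in set1 @` F by rewrite inE; exists x.
exists (SigSub xF) => //.
by have := set_mem (valP sigma) (SigSub xF).
Qed.

Lemma SDT_of_coherent (T : Type) (cl : set T -> set T) (Tm : set T) K :
  closure_operator cl -> K1_to_K4 cl Tm K ->
  cl (SDT_of K) `<=` SDT_of K -> coherent_SDT cl Tm (SDT_of K).
Proof.
move=> [clI _ _] [K1 _ K3 _] clK; split; first by apply/seteqP; split.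
(* For a forbidden [t], K3 would turn [[set t]] into the empty set, against K1. *)
apply/seteqP; split => // t [/K3 Kt Tmt]; apply: K1.
by rewrite (_ : set0 = [set t] `\` Tm) //; apply/esym/seteqP; split => // _ [->].
Qed.

Lemma coherent_SDT_of (T : Type) (cl : set T -> set T) (Tm : set T) K :
  closure_operator cl -> coherent_SDS cl Tm K -> coherent_SDT cl Tm (SDT_of K).
Proof.
move=> clC [K14 K5]; apply: SDT_of_coherent => //.
(* K5 speaks of non-empty families only; if [SDT_of K] is empty, K4 does the work instead. *)
have [[_ _ _ K4] [D0|D0]] := (K14, eqVneq (SDT_of K) set0).
  by rewrite {1}D0.
apply: SDT_of_closure => //; apply: K5; last by move=> _ [x Kx <-].
by move/set0P: D0 => [x Kx]; exists [set x]; exists x.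
Qed.

Lemma finitely_coherent_SDT_of (T : Type) (cl : set T -> set T) (Tm : set T) K :
  closure_operator cl -> finitary cl -> finitely_coherent_SDS cl Tm K ->
  coherent_SDT cl Tm (SDT_of K).
Proof.
move=> clC fin [K14 K5]; apply: SDT_of_coherent => //.
rewrite fin => t [F [FK Ffin] Ft]; have [_ _ _ K4] := K14.
(* The finite set [F] given by finitarity may be empty, and then K4 again replaces K5. *)
have [F0|/set0P [x Fx]] := eqVneq F set0.
  by apply: K4; rewrite -F0.
apply: SDT_of_closure Ft => //; apply: K5; last by move=> _ [y /FK Ky <-].
  by exists [set x]; exists x.
exact: finite_image.
Qed.

(** Abstracting over [A] and [B] lets one argument serve both coherence and finite coherence. *)
Lemma SDS_of_embedding (T : Type) (A : set (set T)) (B : set (set (set T))) :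
  (forall D, A D -> B (SDS_of D)) ->
  (forall K, B K -> A (SDT_of K)) ->
  (forall K S1 S2, B K -> K S1 -> S1 `<=` S2 -> K S2) ->
  [/\ order_embedding A B (@SDS_of T),
      @SDS_of T @` A = B `&` @conjunctive T
    & inverse_between A (@SDS_of T @` A) (@SDS_of T) (@SDT_of T)].
Proof.
move=> AB BA Bup.
have image : @SDS_of T @` A = B `&` @conjunctive T.
  apply/seteqP; split => [_ [D AD <-]|K [BK Kconj]].
    by split; [exact: AB | exact: SDS_of_conjunctive].
  exists (SDT_of K); first exact: BA.
  by apply: SDT_ofK => // S1 S2; apply: Bup.
split=> //; first by split=> // D E _ _; exact: SDS_of_mono.
(* Elements of the image have the form [SDS_of D], so all three claims reduce to the cancellation
   [SDS_ofK]. *)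
split=> [_ [D AD <-]|D _|_ /set_mem [D AD <-]]; by rewrite ?SDS_ofK.
Qed.

Theorem theorem1 (T : Type) (T_nonempty : [set: T] !=set0)
    (cl : set T -> set T) (cl_closure : closure_operator cl)
    (Tm : set T) (Tp_Tm_disjoint : cl set0 `&` Tm = set0) :
  [/\ order_embedding (coherent_SDT cl Tm) (coherent_SDS cl Tm) (@SDS_of T),
      @SDS_of T @` coherent_SDT cl Tm = coherent_SDS cl Tm `&` @conjunctive T
    & inverse_between (coherent_SDT cl Tm) (@SDS_of T @` coherent_SDT cl Tm)
        (@SDS_of T) (@SDT_of T)]
  /\
  (finitary cl ->
   [/\ order_embedding (coherent_SDT cl Tm) (finitely_coherent_SDS cl Tm)
         (@SDS_of T),
       @SDS_of T @` coherent_SDT cl Tm =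
         finitely_coherent_SDS cl Tm `&` @conjunctive T
     & inverse_between (coherent_SDT cl Tm) (@SDS_of T @` coherent_SDT cl Tm)
         (@SDS_of T) (@SDT_of T)]).
Proof.
split=> [|fin]; apply: SDS_of_embedding.
- move=> D DC; split; first exact: SDS_of_K1_to_K4.
  by move=> W _ WD; apply: SDS_of_K5 => //; have [] := DC.
- by move=> K; exact: coherent_SDT_of.
- by move=> K S1 S2 [[_ Kup _ _] _]; exact: Kup.
- move=> D DC; split; first exact: SDS_of_K1_to_K4.
  by move=> W _ _ WD; apply: SDS_of_K5 => //; have [] := DC.
- by move=> K; exact: finitely_coherent_SDT_of.
- by move=> K S1 S2 [[_ Kup _ _] _]; exact: Kup.
Qed.
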